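(* Let $a,b$ be odd integers. For every $k\geq 1$, the graphs $C^{(a,b)}(k)$ and $B(2,k)$ are isomorphic, and the map $\Phi^{(a,b)}_k:\{0,\ldots,2^k-1\}\to\{0,\ldots,2^k-1\}$, $\Phi^{(a,b)}_k(n)=\sum_{i=0}^{k-1} x^{(a,b)}_i(n)\,2^i$, is an isomorphism from $C^{(a,b)}(k)$ to $B(2,k)$. Furthermore, the graphs $C^{(a,b)}(\mathbb{Z}_2)$ and $B(\mathbb{Z}_2)$ are isomorphic, and the map $\Phi^{(a,b)}:\mathbb{Z}_2\to\mathbb{Z}_2$, $\Phi^{(a,b)}(n)=\sum_{i=0}^{\infty} x^{(a,b)}_i(n)\,2^i$, is an isomorphism from $C^{(a,b)}(\mathbb{Z}_2)$ to $B(\mathbb{Z}_2)$ satisfying $T^{(a,b)} = (\Phi^{(a,b)})^{-1}\circ\sigma_2\circ\Phi^{(a,b)}$.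
   Context: All graphs are directed. $\mathbb{Z}_2$ denotes the $2$-adic integers. For odd integers $a,b$, the $an+b$ function $T^{(a,b)}$ (on $\mathbb{Z}$ or on $\mathbb{Z}_2$) is $T^{(a,b)}(n)=(an+b)/2$ if $n$ is odd and $T^{(a,b)}(n)=n/2$ if $n$ is even. Let $x^{(a,b)}_i(n)\in\{0,1\}$ be defined by $x^{(a,b)}_i(n)\equiv (T^{(a,b)})^i(n)\pmod 2$ (the $i$-th iterate, with the $0$-th iterate being $n$). $C^{(a,b)}(k)$ is the directed graph with vertex set $\{0,\ldots,2^k-1\}$ and an edge from $u$ to $v$ iff there exist integers $u_1\equiv u$, $v_1\equiv v \pmod{2^k}$ with $T^{(a,b)}(u_1)=v_1$. $C^{(a,b)}(\mathbb{Z}_2)$ has vertex set $\mathbb{Z}_2$ and edges $n\to T^{(a,b)}(n)$. The binary De Bruijn graph $B(2,k)$ has vertex set $\{0,\ldots,2^k-1\}$, a number $\sum_{i=0}^{k-1}b_i2^i$ ($b_i\in\{0,1\}$) identified with the word $b_0\cdots b_{k-1}$, and an edge from $a_0\cdots a_{k-1}$ to $b_0\cdots b_{k-1}$ iff $a_{i+1}=b_i$ for $i=0,\ldots,k-2$. The shift map $\sigma_2:\mathbb{Z}_2\to\mathbb{Z}_2$ is $\sigma_2(n)=(n-1)/2$ for odd $n$ and $n/2$ for even $n$, and $B(\mathbb{Z}_2)$ is the graph with vertex set $\mathbb{Z}_2$ and edges $n\to\sigma_2(n)$. *)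

(* Defs.v *)
From HB Require Import structures.
From mathcomp Require Import all_boot all_order all_algebra.
From mathcomp Require Import boolp classical_sets.

Set Implicit Arguments.
Unset Strict Implicit.
Unset Printing Implicit Defensive.

Import GRing.Theory.
Local Open Scope ring_scope.

Record digraph := Digraph {
  vertex :> Type;
  edge : vertex -> vertex -> Prop }.

Definition graph_isomorphism (G H : digraph) (f : G -> H) : Prop :=
  bijective f /\ forall u v : G, edge u v <-> edge (f u) (f v).

Definition isomorphic (G H : digraph) : Prop :=
  exists f : G -> H, graph_isomorphism f.

(* The 2-adic integers, as the inverse limit of the rings Z / 2^k Z:
   [residue x k] is the representative of x modulo 2^k in {0, ..., 2^k - 1};
   the range constraint is part of the coherence condition, since [%%] by a
   positive integer is never negative. *)
Record Z2 := MkZ2 {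
  residue : nat -> int;
  residue_coherent : forall k, residue k = (residue k.+1 %% 2 ^+ k)%Z }.

HB.instance Definition _ := gen_eqMixin Z2.
HB.instance Definition _ := gen_choiceMixin Z2.

Lemma Z2_ext (x y : Z2) : (forall k, residue x k = residue y k) -> x = y.
Proof.
case: x y => [r rP] [s sP] /= /funext rs; rewrite {}rs in rP *.
by congr MkZ2; apply: Prop_irrelevance.
Qed.

Lemma modz_pow2S (m : int) k : ((m %% 2 ^+ k.+1)%Z = m %[mod 2 ^+ k])%Z.
Proof.
set r := (m %% _)%Z; rewrite [in RHS](divz_eq m (2 ^+ k.+1)) -/r.
by rewrite [X in _ * X]exprS mulrA modzMDl.
Qed.

Lemma residue_mod (x : Z2) k : (residue x k %% 2 ^+ k)%Z = residue x k.
Proof. by rewrite residue_coherent modz_mod. Qed.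

Lemma residueS (x : Z2) k : (residue x k.+1 = residue x k %[mod 2 ^+ k])%Z.
Proof. by rewrite residue_mod -residue_coherent. Qed.

Lemma Z2_of_coherent_subproof (f : nat -> int)
    (fP : forall k, (f k.+1 = f k %[mod 2 ^+ k])%Z) k :
  (f k %% 2 ^+ k)%Z = ((f k.+1 %% 2 ^+ k.+1)%Z %% 2 ^+ k)%Z.
Proof. by rewrite modz_pow2S fP. Qed.

Definition Z2_of_coherent (f : nat -> int)
    (fP : forall k, (f k.+1 = f k %[mod 2 ^+ k])%Z) : Z2 :=
  MkZ2 (Z2_of_coherent_subproof fP).

Lemma Z2_zero_subproof k : (0 = 0 %[mod 2 ^+ k])%Z. Proof. by []. Qed.
Lemma Z2_one_subproof k : (1 = 1 %[mod 2 ^+ k])%Z. Proof. by []. Qed.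
Lemma Z2_opp_subproof (x : Z2) k :
  (- residue x k.+1 = - residue x k %[mod 2 ^+ k])%Z.
Proof. by rewrite -modzNm residueS modzNm. Qed.
Lemma Z2_add_subproof (x y : Z2) k :
  (residue x k.+1 + residue y k.+1 = residue x k + residue y k %[mod 2 ^+ k])%Z.
Proof. by rewrite -modzDm !residueS modzDm. Qed.
Lemma Z2_mul_subproof (x y : Z2) k :
  (residue x k.+1 * residue y k.+1 = residue x k * residue y k %[mod 2 ^+ k])%Z.
Proof. by rewrite -modzMm !residueS modzMm. Qed.

Definition Z2_zero : Z2 := Z2_of_coherent Z2_zero_subproof.
Definition Z2_one : Z2 := Z2_of_coherent Z2_one_subproof.
Definition Z2_opp (x : Z2) : Z2 := Z2_of_coherent (Z2_opp_subproof x).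
Definition Z2_add (x y : Z2) : Z2 := Z2_of_coherent (Z2_add_subproof x y).
Definition Z2_mul (x y : Z2) : Z2 := Z2_of_coherent (Z2_mul_subproof x y).

Fact Z2_addA : associative Z2_add.
Proof. by move=> x y z; apply: Z2_ext => k /=; rewrite modzDml modzDmr addrA. Qed.
Fact Z2_addC : commutative Z2_add.
Proof. by move=> x y; apply: Z2_ext => k /=; rewrite addrC. Qed.
Fact Z2_add0 : left_id Z2_zero Z2_add.
Proof. by move=> x; apply: Z2_ext => k /=; rewrite modzDml add0r residue_mod. Qed.
Fact Z2_addN : left_inverse Z2_zero Z2_opp Z2_add.
Proof. by move=> x; apply: Z2_ext => k /=; rewrite modzDml addNr. Qed.

HB.instance Definition _ :=
  GRing.isZmodule.Build Z2 Z2_addA Z2_addC Z2_add0 Z2_addN.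

Fact Z2_mulA : associative Z2_mul.
Proof. by move=> x y z; apply: Z2_ext => k /=; rewrite modzMml modzMmr mulrA. Qed.
Fact Z2_mulC : commutative Z2_mul.
Proof. by move=> x y; apply: Z2_ext => k /=; rewrite mulrC. Qed.
Fact Z2_mul1 : left_id Z2_one Z2_mul.
Proof. by move=> x; apply: Z2_ext => k /=; rewrite modzMml mul1r residue_mod. Qed.
Fact Z2_mulDl : left_distributive Z2_mul Z2_add.
Proof.
by move=> x y z; apply: Z2_ext => k /=; rewrite modzMml modzDm mulrDl.
Qed.
Fact Z2_one_neq0 : Z2_one != 0.
Proof. by apply/eqP => /(congr1 (residue^~ 1%N)). Qed.

HB.instance Definition _ := GRing.Zmodule_isComNzRing.Build Z2
  Z2_mulA Z2_mulC Z2_mul1 Z2_mulDl Z2_one_neq0.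

Lemma residue0 k : residue 0 k = 0.
Proof. by rewrite /= mod0z. Qed.
Lemma residue1 k : residue 1 k = (1 %% 2 ^+ k)%Z.
Proof. by []. Qed.
Lemma residueD (x y : Z2) k :
  residue (x + y) k = ((residue x k + residue y k) %% 2 ^+ k)%Z.
Proof. by []. Qed.
Lemma residueN (x : Z2) k : residue (- x) k = (- residue x k %% 2 ^+ k)%Z.
Proof. by []. Qed.
Lemma residueM (x y : Z2) k :
  residue (x * y) k = ((residue x k * residue y k) %% 2 ^+ k)%Z.
Proof. by []. Qed.

Lemma residue_nat (n : nat) k : residue n%:R k = (n%:Z %% 2 ^+ k)%Z.
Proof.
elim: n => [|n IHn]; first by rewrite residue0 mod0z.
by rewrite -natr1 residueD IHn residue1 modzDm intS addrC.
Qed.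

Lemma residue_int (m : int) k : residue m%:~R k = (m %% 2 ^+ k)%Z.
Proof.
case: m => n; first exact: residue_nat.
by rewrite NegzE mulrNz residueN residue_nat modzNm.
Qed.

Definition odd_int (n : int) : bool := ~~ (2 %| n)%Z.

Definition odd_Z2 (n : Z2) : bool := residue n 1 == 1.

Lemma odd_int_mod (n : int) : ((odd_int n : nat)%:Z = n %[mod 2])%Z.
Proof.
rewrite /odd_int; case: dvdz_mod0P => [->|] //=.
have := modz_ge0 n (isT : (2 : int) != 0); have := ltz_mod n (isT : (2 : int) != 0).
by case: (n %% 2)%Z => // -[|[|?]].
Qed.

Lemma odd_Z2_residue (n : Z2) : (odd_Z2 n : nat)%:Z = residue n 1.
Proof.
rewrite /odd_Z2 -(residue_mod n 1) expr1.
have := modz_ge0 (residue n 1) (isT : (2 : int) != 0).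
have := ltz_mod (residue n 1) (isT : (2 : int) != 0).
by case: (residue n 1 %% 2)%Z => // -[|[|?]].
Qed.

Lemma odd_Z2_int (m : int) : odd_Z2 m%:~R = odd_int m.
Proof.
by rewrite /odd_Z2 residue_int expr1 -odd_int_mod; case: odd_int.
Qed.

Lemma half_Z2_subproof (x : Z2) k :
  ((residue x k.+2 %/ 2)%Z = (residue x k.+1 %/ 2)%Z %[mod 2 ^+ k])%Z.
Proof.
rewrite [in RHS]residue_coherent.
set r := residue x k.+2; set d : int := 2 ^+ k.+1.
have {1}-> : r = ((r %/ d)%Z * 2 ^+ k) * 2 + (r %% d)%Z.
  by rewrite -mulrA -exprSr -divz_eq.
by rewrite divzMDl // modzMDl.
Qed.

(* Division by 2, meaningful only for even x (see [half_Z2K]); below it is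
   applied to even arguments only, as soon as a and b are odd. *)
Definition half_Z2 (x : Z2) : Z2 := Z2_of_coherent (half_Z2_subproof x).

Lemma half_Z2K (x : Z2) : ~~ odd_Z2 x -> 2 * half_Z2 x = x.
Proof.
move=> xE; apply: Z2_ext => k.
have r2 : (2 %| residue x k.+1)%Z.
  have x1 : residue x 1 = 0 by rewrite -odd_Z2_residue (negbTE xE).
  elim: k => [|k IHk]; first by rewrite x1.
  move: IHk; rewrite [X in (2 %| X)%Z -> _]residue_coherent => IHk.
  rewrite (divz_eq (residue x k.+2) (2 ^+ k.+1)) rpredD //.
  by rewrite exprS mulrCA dvdz_mulr.
rewrite residueM residue_nat /= modzMm mulrC divzK //.
by rewrite -residue_coherent.
Qed.

Lemma half_Z2_int (m : int) : ~~ odd_int m -> half_Z2 m%:~R = (m %/ 2)%Z%:~R.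
Proof.
rewrite negbK => m2; apply: Z2_ext => k; rewrite residue_int /= residue_int.
set d : int := 2 ^+ k.+1.
have mE : m = ((m %/ d)%Z * 2 ^+ k) * 2 + (m %% d)%Z.
  by rewrite -mulrA -exprSr -divz_eq.
by rewrite [in RHS]mE divzMDl // modzMDl.
Qed.

Definition T_int (a b n : int) : int :=
  if odd_int n then ((a * n + b) %/ 2)%Z else (n %/ 2)%Z.

Definition T_Z2 (a b : int) (n : Z2) : Z2 :=
  if odd_Z2 n then half_Z2 (a%:~R * n + b%:~R) else half_Z2 n.

Lemma T_Z2_int (a b n : int) : odd_int a -> odd_int b ->
  T_Z2 a b n%:~R = (T_int a b n)%:~R.
Proof.
move=> aO bO; rewrite /T_Z2 /T_int odd_Z2_int; case: ifP => nO; last first.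
  by rewrite half_Z2_int ?nO.
rewrite -intrM -intrD half_Z2_int //.
have md2 m : odd_int m -> (m %% 2)%Z = 1 by rewrite -odd_int_mod => ->.
rewrite negbK; apply/dvdz_mod0P.
by rewrite -modzDm -[(a * n %% 2)%Z]modzMm (md2 a) ?(md2 n) ?(md2 b).
Qed.

Definition parity_int (a b : int) (i : nat) (n : int) : nat :=
  odd_int (iter i (T_int a b) n).

Definition parity_Z2 (a b : int) (i : nat) (n : Z2) : nat :=
  odd_Z2 (iter i (T_Z2 a b) n).

Definition C_graph (a b : int) (k : nat) : digraph :=
  @Digraph 'I_(2 ^ k) (fun u v => exists u1 v1 : int,
    [/\ (u1 = (u : nat)%:Z %[mod 2 ^+ k])%Z,
        (v1 = (v : nat)%:Z %[mod 2 ^+ k])%Z & T_int a b u1 = v1]).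

Definition C_graph_Z2 (a b : int) : digraph :=
  @Digraph Z2 (fun u v => v = T_Z2 a b u).

Definition bit (n i : nat) : bool := odd (n %/ 2 ^ i).

Lemma sum_bit (k n : nat) : (n < 2 ^ k)%N ->
  n = (\sum_(i < k) bit n i * 2 ^ i)%N.
Proof.
elim: k n => [|k IHk] n; first by rewrite big_ord0 expn0 ltnS leqn0 => /eqP.
move=> nk; rewrite big_ord_recl /= /bit expn0 divn1 muln1.
rewrite -[LHS]odd_double_half; congr addn.
rewrite [in LHS](IHk n./2); last by rewrite -divn2 ltn_divLR // -expnSr.
rewrite -muln2 big_distrl /=; apply: eq_bigr => i _.
by rewrite /bit /bump /= add1n -divn2 -divnMA -expnS expnSr mulnA.
Qed.

(* The vertex n stands for the word [bit n 0, ..., bit n (k - 1)], see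
   [sum_bit]. *)
Definition B_graph (k : nat) : digraph :=
  @Digraph 'I_(2 ^ k) (fun u v =>
    forall i : nat, (i.+1 < k)%N -> bit u i.+1 = bit v i).

Definition sigma2 (n : Z2) : Z2 :=
  if odd_Z2 n then half_Z2 (n - 1) else half_Z2 n.

Definition B_graph_Z2 : digraph := @Digraph Z2 (fun u v => v = sigma2 u).

Lemma Phi_fin_subproof (a b n : int) (k : nat) :
  (\sum_(i < k) parity_int a b i n * 2 ^ i < 2 ^ k)%N.
Proof.
elim: k => [|k IHk]; first by rewrite big_ord0.
rewrite big_ord_recr /= expnS mul2n -addnn -addSn leq_add //.
by rewrite /parity_int; case: odd_int; rewrite ?mul1n ?mul0n.
Qed.

Definition Phi_fin (a b : int) (k : nat) (n : 'I_(2 ^ k)) : 'I_(2 ^ k) :=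
  Ordinal (Phi_fin_subproof a b (n : nat)%:Z k).

(* Convergence for the 2-adic topology: two 2-adic integers are congruent
   modulo 2^N when their N-th residues agree. *)
Definition Z2_cvg (u : nat -> Z2) (l : Z2) : Prop :=
  forall N : nat, exists K : nat, forall k : nat, (K <= k)%N ->
    residue (u k) N = residue l N.

Lemma Z2_cvg_unique (u : nat -> Z2) (l l' : Z2) :
  Z2_cvg u l -> Z2_cvg u l' -> l = l'.
Proof.
move=> ul ul'; apply: Z2_ext => N; have [K uK] := ul N; have [K' uK'] := ul' N.
by rewrite -(uK (maxn K K')) ?leq_maxl // uK' ?leq_maxr.
Qed.

(* The limit of u, with the default value 0 if u diverges. *)
Definition Z2_lim (u : nat -> Z2) : Z2 := xget 0 [set l | Z2_cvg u l].

Lemma Z2_limP (u : nat -> Z2) (l : Z2) : Z2_cvg u l -> Z2_lim u = l.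
Proof.
move=> ul; apply: (@Z2_cvg_unique u) => //.
by apply: (@xgetPex _ 0 [set l | Z2_cvg u l]); exists l.
Qed.

Definition Phi (a b : int) (n : Z2) : Z2 :=
  Z2_lim (fun k => \sum_(i < k) (parity_Z2 a b i n)%:R * 2 ^+ i).

Lemma residue_sum_pow2 (d : nat -> nat) (k N : nat) :
  residue (\sum_(i < k) (d i)%:R * 2 ^+ i) N =
  ((\sum_(i < k) d i * 2 ^ i)%N%:Z %% 2 ^+ N)%Z.
Proof.
rewrite -residue_nat natr_sum; congr (residue _ N); apply: eq_bigr => i _.
by rewrite natrM natrX.
Qed.

Lemma Z2_pow2_series_cvg (d : nat -> nat) :
  exists2 l : Z2, Z2_cvg (fun k => \sum_(i < k) (d i)%:R * 2 ^+ i) l &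
    forall N, residue l N = ((\sum_(i < N) d i * 2 ^ i)%N%:Z %% 2 ^+ N)%Z.
Proof.
have tail N k : (N <= k)%N -> ((\sum_(i < k) d i * 2 ^ i)%N%:Z =
    (\sum_(i < N) d i * 2 ^ i)%N%:Z %[mod 2 ^+ N])%Z.
  elim: k => [|k IHk]; first by rewrite leqn0 => /eqP->.
  rewrite leq_eqVlt => /orP[/eqP->//|]; rewrite ltnS => Nk.
  rewrite big_ord_recr /= PoszD -(subnK Nk) expnD mulnA (subnK Nk) addrC.
  by rewrite PoszM -[X in _ * X]natz natrX modzMDl IHk.
exists (Z2_of_coherent (fun N => tail N N.+1 (leqnSn N))) => // N.
by exists N => k Nk; rewrite residue_sum_pow2 tail.
Qed.

Lemma Phi_cvg (a b : int) (n : Z2) :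
  Z2_cvg (fun k => \sum_(i < k) (parity_Z2 a b i n)%:R * 2 ^+ i) (Phi a b n).
Proof.
have [l ul _] := Z2_pow2_series_cvg (fun i => parity_Z2 a b i n).
by rewrite /Phi (Z2_limP ul).
Qed.

(* Main.v *)
(** Since 2 T(n) is an odd multiple of n plus a constant depending only on the
    parity of n, two integers agree modulo 2^(k+1) iff they have the same parity
    and their images under T agree modulo 2^k. Hence the first k parities of the
    trajectory of n determine, and are determined by, n modulo 2^k. The case
    (a, b) = (1, -1) of T is the shift map, for which the parities of the
    trajectory are the binary digits; so Phi is the map that matches the parities
    under T with the parities under the shift, and it conjugates T to the shift. *)
Require Import Defs.
From mathcomp Require Import all_boot all_order all_algebra.
From mathcomp Require Import boolp zify ring.

Set Implicit Arguments.
Unset Strict Implicit.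
Unset Printing Implicit Defensive.

Import GRing.Theory.
Local Open Scope ring_scope.

(** * Congruences modulo powers of 2 under T *)

Definition T_coef (a n : int) : int := if odd_int n then a else 1.

Lemma double_T_int (a b n : int) : odd_int a -> odd_int b ->
  2 * T_int a b n = T_coef a n * n + (odd_int n)%:R * b.
Proof.
move=> aO bO; rewrite /T_int /T_coef; case: ifP => nO; last first.
  by move: nO; rewrite /odd_int; lia.
have [[p pE] [q qE]]: (exists p, a = 2 * p + 1) /\ (exists q, n = 2 * q + 1).
  move: aO nO; rewrite /odd_int => aO nO.
  by split; [exists (a %/ 2)%Z | exists (n %/ 2)%Z]; lia.
have -> : a * n = 2 * (2 * p * q + p + q) + 1 by rewrite pE qE; ring.
by move: bO; rewrite /odd_int; lia.
Qed.

Lemma coprime_pow2_T_coef (a n : int) (k : nat) :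
  odd_int a -> coprimez (2 ^+ k) (T_coef a n).
Proof.
move=> aO; rewrite coprimezXl // /T_coef; case: ifP => // _.
move: aO; rewrite /odd_int; rewrite coprimezE /=; rewrite prime_coprime //.
Qed.

Lemma eqmod_pow2W (m n : int) (j k : nat) : (j <= k)%N ->
  (m = n %[mod 2 ^+ k])%Z -> (m = n %[mod 2 ^+ j])%Z.
Proof.
move=> jk /eqP mn; apply/eqP; move: mn; rewrite !eqz_mod_dvd.
by apply: dvdz_trans; rewrite dvdz_exp2l.
Qed.

Lemma eqmodS_T_int (a b m n : int) (k : nat) : odd_int a -> odd_int b ->
  (m = n %[mod 2 ^+ k.+1])%Z <->
  odd_int m = odd_int n /\ (T_int a b m = T_int a b n %[mod 2 ^+ k])%Z.
Proof.
move=> aO bO.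
have iff_dvd : odd_int m = odd_int n ->
    (2 ^+ k.+1 %| m - n)%Z = (2 ^+ k %| T_int a b m - T_int a b n)%Z.
  (* Multiplying by the odd coefficient does not affect divisibility by a power of 2, and equal
     parities make the constant terms cancel. *)
  move=> mn; rewrite -(Gauss_dvdzr _ (coprime_pow2_T_coef n k.+1 aO)).
  have -> : T_coef a n * (m - n) = 2 * (T_int a b m - T_int a b n).
    rewrite [RHS]mulrBr !double_T_int // /T_coef mn; ring.
  by rewrite exprS dvdz_mul2l.
split=> [mn|[mn /eqP]].
  have mnO : odd_int m = odd_int n.
    by have := @eqmod_pow2W m n 1 k.+1 isT mn; rewrite expr1 /odd_int; lia.
  by split=> //; apply/eqP; rewrite eqz_mod_dvd -iff_dvd // -eqz_mod_dvd mn.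
by rewrite eqz_mod_dvd -iff_dvd // -eqz_mod_dvd => /eqP.
Qed.

Lemma parity_intS (a b : int) (i : nat) (n : int) :
  parity_int a b i.+1 n = parity_int a b i (T_int a b n).
Proof. by rewrite /parity_int iterSr. Qed.

Lemma parity_Z2S (a b : int) (i : nat) (n : Z2) :
  parity_Z2 a b i.+1 n = parity_Z2 a b i (T_Z2 a b n).
Proof. by rewrite /parity_Z2 iterSr. Qed.

(* 2 T(n) has an odd linear coefficient in n, and c times an odd number is
   congruent to c modulo 2. *)
Lemma T_int_add_pow2 (a b n c : int) (k : nat) : odd_int a -> odd_int b ->
  (T_int a b (n + c * 2 ^+ k.+1) = T_int a b n + c * 2 ^+ k %[mod 2 ^+ k.+1])%Z.
Proof.
move=> aO bO; set m := n + _.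
have /(eqmodS_T_int m n k aO bO)[mn _] : (m = n %[mod 2 ^+ k.+1])%Z.
  by rewrite /m addrC modzMDl.
have [q qE] : exists q, T_coef a n = 2 * q + 1.
  by exists (T_coef a n %/ 2)%Z; move: aO; rewrite /T_coef /odd_int; case: ifP; lia.
have Tn := double_T_int n aO bO; have Tm := double_T_int m aO bO.
rewrite {1}/T_coef mn -/(T_coef a n) qE {2}/m exprS in Tm; rewrite qE in Tn.
(* With the coefficient written as [2 * q + 1], the two sides differ by exactly
   [c * q * 2 ^+ k.+1]. *)
apply/eqP; rewrite eqz_mod_dvd exprS; apply/dvdzP; exists (c * q).
have alg (t t1 x e : int) : 2 * t = (2 * q + 1) * n + e ->
    2 * t1 = (2 * q + 1) * (n + c * (2 * x)) + e ->
    t1 - (t + c * x) = c * q * (2 * x).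
  move=> tE t1E; have : 2 * (t1 - (t + c * x)) = 2 * (c * q * (2 * x)).
    have -> : 2 * (t1 - (t + c * x)) = 2 * t1 - 2 * c * x - 2 * t by ring.
    by rewrite tE t1E; ring.
  exact: mulfI.
exact: alg Tn Tm.
Qed.

Lemma eqmod_parity (a b m n : int) (k : nat) : odd_int a -> odd_int b ->
  (m = n %[mod 2 ^+ k])%Z <->
  forall i, (i < k)%N -> parity_int a b i m = parity_int a b i n.
Proof.
move=> aO bO; elim: k m n => [|k IHk] m n; first by split; rewrite ?modz1.
rewrite (eqmodS_T_int m n k aO bO) IHk; split=> [[mn Tmn] [|i] ik|mn].
- by rewrite /parity_int /= mn.
- by rewrite !parity_intS Tmn.
split=> [|i ik]; last by rewrite -!parity_intS mn.
by have := mn 0%N isT; rewrite /parity_int /=; do 2!case: odd_int.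
Qed.

(** * Shift parities as binary digits *)

Lemma odd1 : odd_int 1. Proof. by []. Qed.
Lemma oddN1 : odd_int (-1). Proof. by []. Qed.

Lemma T_int_shift (e : bool) (n : int) : T_int 1 (-1) (e%:R + 2 * n) = n.
Proof. by rewrite /T_int /odd_int; case: e => /=; case: ifP; lia. Qed.

Lemma bit_parity (n i : nat) : bit n i = parity_int 1 (-1) i n :> nat.
Proof.
elim: i n => [|i IHi] n.
  by rewrite /bit /parity_int /= /odd_int expn0 divn1; lia.
rewrite parity_intS -[n in RHS]odd_double_half.
have -> : (odd n + n./2.*2)%N%:Z = (odd n)%:R + 2 * n./2%:Z by lia.
by rewrite T_int_shift -IHi /bit expnS divnMA divn2.
Qed.

Lemma sum_pow2_recl (d : nat -> bool) (k : nat) :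
  (\sum_(i < k.+1) d i * 2 ^ i)%N%:Z =
  (d 0)%:R + 2 * (\sum_(i < k) d i.+1 * 2 ^ i)%N%:Z.
Proof.
rewrite big_ord_recl muln1 PoszD -natz; congr (_ + _).
rewrite -PoszM big_distrr /=; congr Posz; apply: eq_bigr => i _.
by rewrite /bump add1n expnS mulnCA.
Qed.

Lemma parity_sum_pow2 (d : nat -> bool) (k i : nat) : (i < k)%N ->
  parity_int 1 (-1) i (\sum_(j < k) d j * 2 ^ j)%N = d i.
Proof.
elim: k i d => // k IHk [|i] d ik; rewrite sum_pow2_recl.
  by rewrite /parity_int /= /odd_int; case: (d 0); lia.
by rewrite parity_intS T_int_shift (IHk _ (fun j => d j.+1)).
Qed.

(** * Parity sequences of 2-adic integers *)

Lemma residue_modn (x : Z2) (j k : nat) : (j <= k)%N ->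
  (residue x k %% 2 ^+ j)%Z = residue x j.
Proof.
move=> /subnKC <-; elim: (k - j)%N => [|m IHm]; first by rewrite addn0 residue_mod.
rewrite -IHm addnS [residue x (j + m)]residue_coherent.
by symmetry; apply: (eqmod_pow2W (leq_addr m j)); rewrite modz_mod.
Qed.

Lemma odd_residue (x : Z2) (k : nat) : odd_int (residue x k.+1) = odd_Z2 x.
Proof. by rewrite -odd_Z2_int /odd_Z2 residue_int residue_modn. Qed.

Lemma half_modz_pow2S (m : int) (k : nat) :
  (((m %% 2 ^+ k.+1)%Z %/ 2)%Z = (m %/ 2)%Z %[mod 2 ^+ k])%Z.
Proof.
rewrite [m in RHS](divz_eq m (2 ^+ k.+1)) [X in _ * X]exprSr mulrA.
by rewrite divzMDl // modzMDl.
Qed.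

Lemma residue_T_Z2 (a b : int) (n : Z2) (k : nat) :
  (residue (T_Z2 a b n) k = T_int a b (residue n k.+1) %[mod 2 ^+ k])%Z.
Proof.
have half x : residue (half_Z2 x) k = ((residue x k.+1 %/ 2)%Z %% 2 ^+ k)%Z by [].
rewrite /T_Z2 /T_int odd_residue; case: ifP => _; rewrite half modz_mod //.
rewrite residueD residueM !residue_int modzMml modzDm.
exact: half_modz_pow2S.
Qed.

Section ParityVectors.

Variables a b : int.
Hypotheses (aO : odd_int a) (bO : odd_int b).

(** Each application of T costs one binary digit of precision, so after [i < k] steps at least one
    of the [k] known digits is left. This carries the results on integers over to [Z2]. *)
Lemma parity_Z2_residue (n : Z2) (k i : nat) : (i < k)%N ->
  parity_Z2 a b i n = parity_int a b i (residue n k).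
Proof.
elim: i n k => [|i IHi] n [|k] // ik.
  by rewrite /parity_Z2 /parity_int /= odd_residue.
rewrite parity_Z2S parity_intS (IHi _ k) //.
by apply: (eqmod_parity _ _ k aO bO).1 => //; apply: residue_T_Z2.
Qed.

Lemma parity_Z2_inj (x y : Z2) :
  (forall i, parity_Z2 a b i x = parity_Z2 a b i y) -> x = y.
Proof.
move=> xy; apply: Z2_ext => k; rewrite -residue_mod -[RHS]residue_mod.
apply/(eqmod_parity _ _ _ aO bO) => i ik.
by rewrite -!parity_Z2_residue.
Qed.

(* Flipping the k-th binary digit of n preserves the first k parities and, since
   the first k+1 parities determine n modulo 2^(k+1), must flip the k-th. *)
Lemma parity_int_flip (n : int) (k : nat) :
  (parity_int a b k (n + 2 ^+ k) = 1 - parity_int a b k n)%N.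
Proof.
suff : parity_int a b k (n + 2 ^+ k) <> parity_int a b k n.
  by rewrite /parity_int; do 2!case: odd_int.
move=> eqk.
have /eqP : (n + 2 ^+ k = n %[mod 2 ^+ k.+1])%Z.
  apply/(eqmod_parity _ _ _ aO bO) => i.
  rewrite ltnS leq_eqVlt => /orP[/eqP-> //|ik].
  by apply: (eqmod_parity _ _ k aO bO).1 => //; rewrite modzDr.
(* The congruence would make [2 ^+ k.+1] divide [2 ^+ k]. *)
rewrite eqz_mod_dvd addrAC subrr add0r -[X in (_ %| X)%Z]mulr1 exprSr.
by rewrite dvdz_mul2l ?expf_neq0.
Qed.

(** Builds digit by digit an integer whose first [k] parities are prescribed by [d]: a new digit 1
    is added exactly when the next parity would be wrong. *)
Fixpoint parity_lift (d : nat -> bool) (k : nat) : int :=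
  if k is j.+1 then
    let r := parity_lift d j in
    if parity_int a b j r == d j then r else r + 2 ^+ j
  else 0.

Lemma parity_lift_coherent (d : nat -> bool) (k : nat) :
  (parity_lift d k.+1 = parity_lift d k %[mod 2 ^+ k])%Z.
Proof. by rewrite /=; case: ifP; rewrite ?modzDr. Qed.

Lemma parity_int_lift (d : nat -> bool) (k i : nat) : (i < k)%N ->
  parity_int a b i (parity_lift d k) = d i.
Proof.
elim: k => // k IHk; rewrite ltnS leq_eqVlt => /orP[/eqP->|ik]; last first.
  rewrite -(IHk ik); apply: (eqmod_parity _ _ k aO bO).1 => //.
  exact: parity_lift_coherent.
rewrite /=; case: ifP => [/eqP//|].
rewrite parity_int_flip {1 2}/parity_int; case: odd_int; case: (d k) => //.
Qed.

(** The successive lifts are coherent modulo growing powers of 2, so together they form one 2-adic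
    integer. *)
Lemma parity_Z2_surj (d : nat -> bool) :
  exists x : Z2, forall i, parity_Z2 a b i x = d i.
Proof.
exists (Z2_of_coherent (parity_lift_coherent d)) => i.
rewrite (parity_Z2_residue _ (ltnSn i)) -(parity_int_lift d (ltnSn i)).
by apply: (eqmod_parity _ _ i.+1 aO bO).1 => //; rewrite modz_mod.
Qed.

End ParityVectors.

(** * Conjugation of T with the shift *)

Lemma sigma2E : sigma2 =1 T_Z2 1 (-1).
Proof. by move=> n; rewrite /T_Z2 mul1r. Qed.

Lemma parity_Phi (a b : int) (n : Z2) (i : nat) :
  parity_Z2 1 (-1) i (Phi a b n) = parity_Z2 a b i n.
Proof.
have [l ul lE] := Z2_pow2_series_cvg (fun i => parity_Z2 a b i n).
rewrite /Phi (Z2_limP ul) (parity_Z2_residue odd1 oddN1 _ (ltnSn i)) lE.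
rewrite -[RHS](parity_sum_pow2 (fun i => odd_Z2 (iter i (T_Z2 a b) n)) (ltnSn i)).
by apply: (eqmod_parity _ _ i.+1 odd1 oddN1).1 => //; rewrite modz_mod.
Qed.

(** On both sides the shift parities are the T-parities of [n] with the first one dropped, and shift
    parities determine a 2-adic integer. *)
Lemma Phi_T_Z2 (a b : int) (n : Z2) : Phi a b (T_Z2 a b n) = sigma2 (Phi a b n).
Proof.
rewrite sigma2E; apply: (parity_Z2_inj odd1 oddN1) => i.
by rewrite -parity_Z2S !parity_Phi parity_Z2S.
Qed.

Lemma bit_Phi_fin (a b : int) (k i : nat) (n : 'I_(2 ^ k)) : (i < k)%N ->
  bit (Phi_fin a b n) i = parity_int a b i n :> nat.
Proof.
move=> ik; rewrite bit_parity /=.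
exact: (parity_sum_pow2 (fun i => odd_int (iter i (T_int a b) n))).
Qed.

Lemma Phi_fin_inj (a b : int) (k : nat) : odd_int a -> odd_int b ->
  injective (@Phi_fin a b k).
Proof.
move=> aO bO m n mn; apply: val_inj => /=.
have : (m = n %[mod 2 ^+ k])%Z.
  apply/(eqmod_parity _ _ _ aO bO) => i ik.
  by rewrite -!bit_Phi_fin // mn.
have lt2 (p : 'I_(2 ^ k)) : (p %% 2 ^+ k)%Z = p :> int.
  have -> : 2 ^+ k = (2 ^ k)%N%:Z by rewrite -natz natrX.
  by rewrite modz_nat modn_small.
by rewrite !lt2 => -[].
Qed.

Lemma Phi_fin_edge (a b : int) (k : nat) (u v : 'I_(2 ^ k)) :
  odd_int a -> odd_int b -> (0 < k)%N ->
  @edge (C_graph a b k) u v <-> @edge (B_graph k) (Phi_fin a b u) (Phi_fin a b v).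
Proof.
move=> aO bO; case: k u v => // k u v _; split=> /= [[u1 [v1 [uu1 vv1 Tu1]]] i ik|uv].
  suff : bit (Phi_fin a b u) i.+1 = bit (Phi_fin a b v) i :> nat.
    by do 2!case: bit.
  rewrite !bit_Phi_fin ?(ltnW ik) //.
  have /(_ i (ltnW ik)) <- := (eqmod_parity _ _ _ aO bO).1 vv1.
  have /(_ i.+1 ik) <- := (eqmod_parity _ _ _ aO bO).1 uu1.
  by rewrite parity_intS Tu1.
(* The words overlap in only [k] of their [k.+1] letters, so the congruence is one power of 2
   short. *)
have : (v = T_int a b u %[mod 2 ^+ k])%Z.
  apply/(eqmod_parity _ _ _ aO bO) => i ik.
  by rewrite -parity_intS -!bit_Phi_fin ?uv // ltnW.
move/eqP; rewrite eqz_mod_dvd => /dvdzP[c cE].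
(* Here [c * 2 ^+ k] is the gap between [v] and the image of [u]. Another representative of the same
   vertex closes it, as its image moves by that amount modulo [2 ^+ k.+1]. *)
exists (u%:Z + c * 2 ^+ k.+1), (T_int a b (u%:Z + c * 2 ^+ k.+1)); split=> //.
  by rewrite addrC modzMDl.
by rewrite T_int_add_pow2 // -cE addrC subrK.
Qed.

Theorem theorem3 (a b : int) (ha : odd_int a) (hb : odd_int b) :
  (forall k : nat, (1 <= k)%N ->
     isomorphic (C_graph a b k) (B_graph k) /\
     graph_isomorphism (G := C_graph a b k) (H := B_graph k) (@Phi_fin a b k))
  /\
  (isomorphic (C_graph_Z2 a b) B_graph_Z2 /\
   graph_isomorphism (G := C_graph_Z2 a b) (H := B_graph_Z2) (Phi a b) /\
   exists Phi_inv : Z2 -> Z2,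
     cancel (Phi a b) Phi_inv /\ cancel Phi_inv (Phi a b) /\
     T_Z2 a b =1 Phi_inv \o (sigma2 \o Phi a b)).
Proof.
split=> [k k1|].
  have iso : graph_isomorphism (G := C_graph a b k) (H := B_graph k)
      (@Phi_fin a b k).
    split; first exact: injF_bij (Phi_fin_inj ha hb).
    by move=> u v; apply: Phi_fin_edge.
  by split=> //; exists (@Phi_fin a b k).
have Phi_inj : injective (Phi a b).
  move=> x y xy; apply: (parity_Z2_inj ha hb) => i.
  by rewrite -(parity_Phi a b x) xy parity_Phi.
have Phi_surj y : exists x, Phi a b x = y.
  (* A preimage of [y] is a point whose T-parities are the shift parities of [y]. *)
  have [x xP] := parity_Z2_surj ha hb (fun i => odd_Z2 (iter i (T_Z2 1 (-1)) y)).
  by exists x; apply: (parity_Z2_inj odd1 oddN1) => i; rewrite parity_Phi xP.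
have [g gK] := choice Phi_surj.
have Kg : cancel (Phi a b) g by move=> x; apply: Phi_inj; rewrite gK.
have iso : graph_isomorphism (G := C_graph_Z2 a b) (H := B_graph_Z2) (Phi a b).
  split; first by exists g.
  by move=> u v /=; rewrite -Phi_T_Z2; split=> [->//|/Phi_inj].
split; first by exists (Phi a b).
split=> //; exists g; split=> //; split=> // x /=.
by rewrite -Phi_T_Z2 Kg.
Qed.
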